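(* Let $u\colon\mathbb Z_2\to\mathbb Z_2$ be an arbitrary 1-Lipschitz function (with respect to the 2-adic metric), and let $s,r\in\{1,2,3,\ldots\}$. The function $f\colon\mathbb Z_2\to\mathbb Z_2$, $f(x)=x^s+2^{r+1}u(x)$, is ergodic on the sphere $\mathbf S_{2^{-r}}(1)=\{1+2^r+2^{r+1}x\colon x\in\mathbb Z_2\}$ if and only if $s\equiv 1\pmod 4$ and $u(1)\equiv 1\pmod 2$.
   Context: $\mathbb Z_2$ is the ring of 2-adic integers, $|\cdot|_2$ the 2-adic absolute value. A function $u\colon\mathbb Z_2\to\mathbb Z_2$ is 1-Lipschitz if $|u(x)-u(y)|_2\le|x-y|_2$ for all $x,y\in\mathbb Z_2$. The sphere is $\mathbf S_{2^{-r}}(1)=\{z\in\mathbb Z_2\colon|z-1|_2=2^{-r}\}=1+2^r+2^{r+1}\mathbb Z_2$. The function $f$ is called ergodic on $\mathbf S_{2^{-r}}(1)$ if $f(\mathbf S_{2^{-r}}(1))\subset\mathbf S_{2^{-r}}(1)$ and the restriction of $f$ to $\mathbf S_{2^{-r}}(1)$ is measure-preserving and ergodic with respect to the Haar measure of $\mathbb Z_2$ restricted to the sphere and normalized to a probability measure (ergodic: every measurable $E\subset\mathbf S_{2^{-r}}(1)$ whose preimage under the restricted map equals $E$ has measure 0 or 1). *)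

(* Defs.v *)
From HB Require Import structures.
From mathcomp Require Import all_boot all_order all_algebra.
From mathcomp Require Import all_classical all_reals all_analysis.
From mathcomp Require Import ring lra zify.

Set Implicit Arguments.
Unset Strict Implicit.
Unset Printing Implicit Defensive.

Import Order.TTheory GRing.Theory Num.Theory.
Import numFieldNormedType.Exports.

Local Open Scope classical_set_scope.
Local Open Scope ring_scope.

(* The 2-adic integers as the inverse limit of the rings Z/2^n Z: [res x n] is
   the representative of x mod 2^n in {0, ..., 2^n - 1}.  The single equation
   [resE] expresses both the range of [res x n] and compatibility with
   reduction mod 2^n. *)
Record Z2 := MkZ2 {
  res : nat -> int;
  resE : forall n, (res n.+1 %% 2 ^+ n)%Z = res n }.

HB.instance Definition _ := gen_eqMixin Z2.
HB.instance Definition _ := gen_choiceMixin Z2.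

Lemma Z2_eq (x y : Z2) : (forall n, res x n = res y n) -> x = y.
Proof.
case: x y => [a Ha] [b Hb] /= /funext ab; subst b; congr MkZ2.
exact: Prop_irrelevance.
Qed.

Lemma dvdz_pow2 (m n : nat) : (m <= n)%N -> (2 ^+ m %| 2 ^+ n)%Z.
Proof. exact: dvdz_exp2l. Qed.

Lemma modz_dvd (m d n : int) : (d %| n)%Z -> ((m %% n)%Z = m %[mod d])%Z.
Proof.
by case/dvdzP => k ->; rewrite [in RHS](divz_eq m (k * d)) mulrA modzMDl.
Qed.

Definition compat (a : nat -> int) := forall n, (a n.+1 = a n %[mod 2 ^+ n])%Z.

Fact Z2_of_subproof a : compat a ->
  forall n, ((a n.+1 %% 2 ^+ n.+1)%Z %% 2 ^+ n)%Z = (a n %% 2 ^+ n)%Z.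
Proof. by move=> Ha n; rewrite modz_dvd ?dvdz_pow2. Qed.

Definition Z2_of a (Ha : compat a) : Z2 := MkZ2 (Z2_of_subproof Ha).

Lemma res_mod x n : (res x n %% 2 ^+ n)%Z = res x n.
Proof. by rewrite -resE modz_mod. Qed.

Lemma res_compat x : compat (res x).
Proof. by move=> n; rewrite resE res_mod. Qed.

Lemma res_mod_le x m n : (m <= n)%N -> (res x n %% 2 ^+ m)%Z = res x m.
Proof.
move=> /subnK<-; elim: (n - m)%N => [|k IH]; first by rewrite res_mod.
by rewrite addSn -IH -[in RHS]resE modz_dvd// dvdz_pow2// leq_addl.
Qed.

Fact Z2_zero_subproof : compat (fun=> 0).
Proof. by []. Qed.
Fact Z2_one_subproof : compat (fun=> 1).
Proof. by []. Qed.
Fact Z2_opp_subproof x : compat (fun n => - res x n).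
Proof. by move=> n /=; rewrite -modzNm (res_compat x n) modzNm. Qed.
Fact Z2_add_subproof x y : compat (fun n => res x n + res y n).
Proof.
by move=> n /=; rewrite -modzDm (res_compat x n) (res_compat y n) modzDm.
Qed.
Fact Z2_mul_subproof x y : compat (fun n => res x n * res y n).
Proof.
by move=> n /=; rewrite -modzMm (res_compat x n) (res_compat y n) modzMm.
Qed.

Definition Z2_zero := Z2_of Z2_zero_subproof.
Definition Z2_one := Z2_of Z2_one_subproof.
Definition Z2_opp x := Z2_of (Z2_opp_subproof x).
Definition Z2_add x y := Z2_of (Z2_add_subproof x y).
Definition Z2_mul x y := Z2_of (Z2_mul_subproof x y).

Fact Z2_addA : associative Z2_add.
Proof. by move=> x y z; apply: Z2_eq => n /=; rewrite modzDml modzDmr addrA. Qed.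
Fact Z2_addC : commutative Z2_add.
Proof. by move=> x y; apply: Z2_eq => n /=; rewrite addrC. Qed.
Fact Z2_add0 : left_id Z2_zero Z2_add.
Proof. by move=> x; apply: Z2_eq => n /=; rewrite modzDml add0r res_mod. Qed.
Fact Z2_addN : left_inverse Z2_zero Z2_opp Z2_add.
Proof. by move=> x; apply: Z2_eq => n /=; rewrite modzDml addNr. Qed.

HB.instance Definition _ := GRing.isZmodule.Build Z2
  Z2_addA Z2_addC Z2_add0 Z2_addN.

Fact Z2_mulA : associative Z2_mul.
Proof. by move=> x y z; apply: Z2_eq => n /=; rewrite modzMml modzMmr mulrA. Qed.
Fact Z2_mulC : commutative Z2_mul.
Proof. by move=> x y; apply: Z2_eq => n /=; rewrite mulrC. Qed.
Fact Z2_mul1 : left_id Z2_one Z2_mul.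
Proof. by move=> x; apply: Z2_eq => n /=; rewrite modzMml mul1r res_mod. Qed.
Fact Z2_mulD : left_distributive Z2_mul Z2_add.
Proof.
by move=> x y z; apply: Z2_eq => n /=; rewrite modzMml modzDm mulrDl.
Qed.
Fact Z2_one_neq0 : Z2_one != Z2_zero.
Proof. by apply/eqP => /(congr1 (res^~ 1)). Qed.

HB.instance Definition _ := GRing.Zmodule_isComNzRing.Build Z2
  Z2_mulA Z2_mulC Z2_mul1 Z2_mulD Z2_one_neq0.

Lemma res0 n : res 0 n = 0. Proof. exact: mod0z. Qed.
Lemma res1 n : res 1 n = (1 %% 2 ^+ n)%Z. Proof. by []. Qed.
Lemma resN x n : res (- x) n = ((- res x n) %% 2 ^+ n)%Z. Proof. by []. Qed.
Lemma resD x y n : res (x + y) n = ((res x n + res y n) %% 2 ^+ n)%Z.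
Proof. by []. Qed.
Lemma resM x y n : res (x * y) n = ((res x n * res y n) %% 2 ^+ n)%Z.
Proof. by []. Qed.
Lemma res_nat k n : res k%:R n = (k %% 2 ^+ n)%Z.
Proof.
elim: k => [|k IH]; first by rewrite res0 mod0z.
by rewrite -natr1 resD IH res1 modzDm intS addrC.
Qed.

Lemma res_pow2 k n : res (2 ^+ k) n = (2 ^+ k %% 2 ^+ n)%Z.
Proof. by rewrite -natrX res_nat -natz natrX. Qed.

(* |x|_2 = 2^-v with v the 2-adic valuation: v + 1 is the least n such that
   x <> 0 mod 2^n.  The values lie in rat. *)
Definition abs2 (x : Z2) : rat :=
  if pselect (exists n, res x n != 0) is left ex then 2 ^- (ex_minn ex).-1
  else 0.

Lemma le_pow2V (m n : nat) : (2 ^- m <= 2 ^- n :> rat) = (n <= m)%N.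
Proof. by rewrite lef_pV2 ?posrE ?exprn_gt0// ler_eXn2l. Qed.

Lemma abs2_le x n : (abs2 x <= 2 ^- n) = (res x n == 0).
Proof.
rewrite /abs2; case: pselect => [ex|nex]; last first.
  rewrite invr_ge0 exprn_ge0//; apply/esym/negPn/negP => xn.
  by apply: nex; exists n.
case: ex_minnP => m xm mmin; rewrite le_pow2V.
have m0 : (0 < m)%N.
  by case: m xm {mmin} => //; rewrite -res_mod expr0 modz1.
rewrite -ltnS prednK//; apply/idP/idP => [nm|/eqP xn0].
  by apply: contraTT nm => /mmin; rewrite -leqNgt.
rewrite ltnNge; apply: contra xm => /(res_mod_le x) <-.
by rewrite xn0 mod0z.
Qed.

Lemma abs2_ge0 x : 0 <= abs2 x.
Proof. by rewrite /abs2; case: pselect => // ?; rewrite invr_ge0 exprn_ge0. Qed.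

Lemma abs2_eq0 x : (abs2 x == 0) = (x == 0).
Proof.
apply/eqP/eqP => [x0|->].
  by apply: Z2_eq => n; rewrite res0; apply/eqP; rewrite -abs2_le x0 invr_ge0 exprn_ge0.
by rewrite /abs2; case: pselect => // ex; exfalso; case: ex => n; rewrite res0.
Qed.

Lemma abs2_pow x : abs2 x != 0 -> exists k, abs2 x = 2 ^- k.
Proof.
rewrite /abs2; case: pselect => [ex _|]; last by rewrite eqxx.
by exists (ex_minn ex).-1.
Qed.

Lemma abs2N x : abs2 (- x) = abs2 x.
Proof.
have h y n : res y n = 0 -> res (- y) n = 0 by rewrite resN => ->; rewrite oppr0 mod0z.
have E : (fun n => res (- x) n != 0) = (fun n => res x n != 0).
  apply/funext => n; congr (~~ _); apply/eqP/eqP => /h//.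
  by rewrite opprK.
pose F (P : pred nat) : rat :=
  if pselect (exists n, P n) is left ex then 2 ^- (ex_minn ex).-1 else 0.
by rewrite -[LHS]/(F _) E.
Qed.

Lemma abs2D x y : abs2 (x + y) <= Num.max (abs2 x) (abs2 y).
Proof.
wlog yx : x y / abs2 y <= abs2 x.
  move=> H; case/orP: (le_total (abs2 y) (abs2 x)) => /H//.
  by rewrite addrC maxC.
rewrite le_max; apply/orP; left.
have [x0|x0] := eqVneq (abs2 x) 0.
  have /eqP := x0; rewrite abs2_eq0 => /eqP ->; rewrite add0r.
  by rewrite x0 in yx; rewrite (le_trans yx)// abs2_ge0.
have [k xk] := abs2_pow x0.
move: (lexx (abs2 x)) yx; rewrite {2 3 4}xk !abs2_le => /eqP hx /eqP hy.
by rewrite resD hx hy mod0z.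
Qed.

Definition Z2_dist (x y : Z2) : rat := abs2 (x - y).

Fact Z2_distxx x : Z2_dist x x = 0.
Proof. by apply/eqP; rewrite /Z2_dist subrr abs2_eq0. Qed.
Fact Z2_dist_eq0 x y : Z2_dist x y = 0 -> x = y.
Proof. by move/eqP; rewrite abs2_eq0 subr_eq0 => /eqP. Qed.
Fact Z2_dist_sym x y : Z2_dist x y = Z2_dist y x.
Proof. by rewrite /Z2_dist -abs2N opprB. Qed.
Fact Z2_dist_triangle y x z : Z2_dist x z <= Z2_dist x y + Z2_dist y z.
Proof.
rewrite /Z2_dist -[x](subrK y) -addrA (le_trans (abs2D _ _))//.
by rewrite subrK ge_max lerDl lerDr !abs2_ge0.
Qed.

HB.instance Definition _ := isPointed.Build Z2 0.
HB.instance Definition _ := isMetric.Build rat Z2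
  Z2_distxx Z2_dist_eq0 Z2_dist_sym Z2_dist_triangle.

HB.instance Definition _ := Measurable.copy Z2 (g_sigma_algebraType (@open Z2)).

Lemma measurable_Z2E : @measurable _ Z2 = <<s @open Z2 >>.
Proof. by []. Qed.

Definition sphere (c : Z2) (e : rat) : set Z2 := [set z | abs2 (z - c) = e].

Lemma Z2_divides x k : res x k = 0 -> exists y, x = 2 ^+ k * y.
Proof.
move=> xk.
have d n : (2 ^+ k %| res x (n + k)%N)%Z.
  by apply/dvdz_mod0P; rewrite res_mod_le ?leq_addl.
have Hc : compat (fun n => (res x (n + k)%N %/ 2 ^+ k)%Z).
  move=> n; rewrite addSn.
  have := divz_eq (res x (n + k).+1) (2 ^+ (n + k)).
  rewrite resE; set q := (_ %/ _)%Z => E.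
  have -> : (res x (n + k).+1 %/ 2 ^+ k)%Z
          = q * 2 ^+ n + (res x (n + k)%N %/ 2 ^+ k)%Z.
    by rewrite E exprD mulrA divzMDl// expf_neq0.
  by rewrite modzMDl.
exists (Z2_of Hc); apply: Z2_eq => n.
rewrite resM res_pow2 /= modzMm [(2 ^+ k * _)]mulrC divzK//.
by rewrite res_mod_le ?leq_addr.
Qed.

Lemma abs2_eq x n : (abs2 x == 2 ^- n) = (res x n == 0) && (res x n.+1 != 0).
Proof.
rewrite -!abs2_le; have [->|/abs2_pow[k ->]] := eqVneq (abs2 x) 0.
  by rewrite !invr_ge0 !exprn_ge0// eq_sym invr_eq0 expf_eq0 andbF.
by rewrite eq_le !le_pow2V -ltnNge ltnS.
Qed.

Lemma res_mul_pow2 x k n : (n <= k)%N -> res (2 ^+ k * x) n = 0.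
Proof.
by move=> nk; rewrite resM res_pow2 (dvdz_mod0P (dvdz_pow2 nk)) mul0r mod0z.
Qed.

Lemma sphereE r :
  sphere 1 (2 ^- r) = [set 1 + 2 ^+ r + 2 ^+ r.+1 * x | x in setT].
Proof.
have p0 : (0 : int) < 2 ^+ r by rewrite exprn_gt0.
have r2 : res (2 ^+ r) r.+1 = 2 ^+ r.
  by rewrite res_pow2 modz_small// exprn_ge0// ltr_eXn2l /=.
apply/seteqP; split => z /=.
  move/eqP; rewrite abs2_eq => /andP[/eqP z0 z1].
  have zE : res (z - 1) r.+1 = 2 ^+ r.
    have := divz_eq (res (z - 1) r.+1) (2 ^+ r); rewrite resE z0 addr0.
    set q := (_ %/ _)%Z => E.
    have q0 : q != 0 by apply: contraNneq z1 => q0; rewrite E q0 mul0r.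
    have : 0 <= res (z - 1) r.+1 < 2 ^+ r.+1.
      rewrite -(res_mod (z - 1) r.+1); apply/andP; split.
        by rewrite modz_ge0// expf_neq0.
      by rewrite ltz_pmod// exprn_gt0.
    rewrite E exprS pmulr_lge0// ltr_pM2r// => q2.
    have -> : q = 1; last by rewrite mul1r.
    clear -q0 q2; clearbody q; lia.
  have [|x xE] := @Z2_divides (z - 1 - 2 ^+ r) r.+1.
    by rewrite resD resN zE r2 modzDmr subrr mod0z.
  by exists x => //; rewrite -xE; ring.
move=> [x _ <-]; apply/eqP; rewrite abs2_eq.
have -> : 1 + 2 ^+ r + 2 ^+ r.+1 * x - 1 = 2 ^+ r + 2 ^+ r.+1 * x by ring.
rewrite !resD !res_mul_pow2// r2 !addr0 res_pow2 modzz mod0z eqxx /=.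
by rewrite modz_small ?gt_eqF// ltW//= ltr_eXn2l.
Qed.

Section measure_dynamics.
Context d (T : measurableType d) (R : realType).
Variables (mu : {measure set T -> \bar R}) (S : set T).

(* mu restricted to S and normalized to a probability measure *)
Definition normalized_restr (E : set T) : \bar R := (mu (E `&` S) / mu S)%E.

Definition measure_preserving_on (f : T -> T) :=
  measurable_fun S f /\
  forall E, measurable E -> E `<=` S ->
    normalized_restr (S `&` f @^-1` E) = normalized_restr E.

Definition ergodic_on (f : T -> T) :=
  [/\ f @` S `<=` S,
      measure_preserving_on f &
      forall E, measurable E -> E `<=` S -> S `&` f @^-1` E = E ->
        normalized_restr E = 0%E \/ normalized_restr E = 1%E].

End measure_dynamics.

(* Haar measure of Z2, normalized by the type [probability]. *)
Definition haar (R : realType) (mu : probability Z2 R) :=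
  forall (a : Z2) (A : set Z2), measurable A -> mu [set a + x | x in A] = mu A.

Definition lipschitz1 (u : Z2 -> Z2) :=
  forall x y, abs2 (u x - u y) <= abs2 (x - y).

Definition cyl (n : nat) (a : int) : set Z2 := [set x | res x n = a].

Lemma ball_Z2E (x : Z2) (e : rat) : ball x e = [set y | abs2 (x - y) < e].
Proof. by []. Qed.

Lemma ball_cyl (x : Z2) n : ball x ((2 : rat) ^- n) `<=` cyl n (res x n).
Proof.
rewrite ball_Z2E => y /ltW; rewrite abs2_le => /eqP xy.
by rewrite /cyl /= -[x](subrK y) resD xy add0r res_mod.
Qed.

Lemma cyl_ball (x : Z2) n : cyl n.+1 (res x n.+1) `<=` ball x ((2 : rat) ^- n).
Proof.
rewrite ball_Z2E => y xy; apply: (@le_lt_trans _ _ (2 ^- n.+1)).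
  by rewrite abs2_le resD resN xy modzDmr subrr mod0z.
by rewrite ltf_pV2 ?posrE ?exprn_gt0// ltr_eXn2l.
Qed.

Lemma open_cyl n a : open (cyl n a).
Proof.
rewrite openE => x <-; apply/nbhs_ballP; exists (2 ^- n) => /=.
  by rewrite invr_gt0 exprn_gt0.
exact: ball_cyl.
Qed.

Lemma open_bigcup_cyl (A : set Z2) : open A ->
  A = \bigcup_(p in [set p : nat * int | cyl p.1 p.2 `<=` A]) cyl p.1 p.2.
Proof.
move=> oA; apply/seteqP; split => [x Ax|x [p pA]]; last exact: pA.
have /nbhs_ballP[e /= e0 eA] := open_nbhs_nbhs (conj oA Ax).
have [n ne] : exists n, (2 : rat) ^- n < e.
  exists (Num.bound e^-1); rewrite invf_plt ?posrE ?exprn_gt0//.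
  apply: (lt_trans (archi_boundP _)); first by rewrite invr_ge0 ltW.
  by rewrite -natrX ltr_nat ltn_expl.
exists (n.+1, res x n.+1) => //= y /cyl_ball.
by move/(le_ball (ltW ne)); exact: eA.
Qed.

Definition cyls : set (set Z2) := [set A | A = set0 \/ exists n a, A = cyl n a].

Lemma measurable_cylsE : @measurable _ Z2 = <<s cyls >>.
Proof.
rewrite measurable_Z2E; apply/seteqP; split; apply: smallest_sub.
- exact: smallest_sigma_algebra.
- move=> A /open_bigcup_cyl ->.
  rewrite bigcup_mkcond.
  apply: (@countable_bigcupT_measurable _ (g_sigma_algebraType cyls)) => // p.
  case: ifP => _; last exact: measurable0.
  by apply: sub_sigma_algebra; right; exists p.1, p.2.
- exact: smallest_sigma_algebra.
- move=> A [->|[n [a ->]]]; first exact: sigma_algebra0.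
  by apply: sub_sigma_algebra; exact: open_cyl.
Qed.

Lemma setI_cyl m n a b : (m <= n)%N ->
  cyl m a `&` cyl n b = if (b %% 2 ^+ m)%Z == a then cyl n b else set0.
Proof.
move=> mn; rewrite /cyl; case: ifPn => [/eqP ba|/eqP ba]; apply/seteqP; split => x //=.
- by case.
- by move=> xn; split => //; rewrite -(res_mod_le x mn) xn.
- by case=> xm xn; apply: ba; rewrite -xn res_mod_le.
Qed.

Lemma setI_closed_cyls : setI_closed cyls.
Proof.
move=> A B [->|[m [a ->]]]; first by rewrite set0I; left.
move=> [->|[n [b ->]]]; first by rewrite setI0; left.
by case/orP: (leq_total m n) => mn; [|rewrite setIC]; rewrite setI_cyl//;
  case: ifP => _; by [left | right; do 2 eexists].
Qed.

Lemma measurable_cyl n a : measurable (cyl n a).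
Proof. by rewrite measurable_Z2E; apply: sub_sigma_algebra; exact: open_cyl. Qed.

Lemma Z2_measure_unique (R : realType) (m1 m2 : {measure set Z2 -> \bar R}) :
  (m1 setT < +oo)%E -> (forall n a, m1 (cyl n a) = m2 (cyl n a)) ->
  forall A, measurable A -> m1 A = m2 A.
Proof.
move=> m1oo m12; have T0 : cyl 0 0 = setT.
  apply/seteqP; split => // x _; rewrite /cyl /= -res_mod expr0 modz1//.
apply: (measure_unique cyls (fun=> setT)) => //.
- exact: measurable_cylsE.
- exact: setI_closed_cyls.
- by move=> _; right; exists 0%N, 0.
- by apply/seteqP; split => // x _; exists 0%N.
- by move=> A [->|[n [a ->]]]; rewrite ?measure0.
Qed.

(* Reversal of the last n binary digits.  If t is uniform on [0, 1[, the binary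
   digits of t, read as 2-adic digits, give a Haar-distributed 2-adic integer;
   bitrev n (floor (2^n t)) is its residue mod 2^n. *)
Fixpoint bitrev (n : nat) (k : int) : int :=
  if n is m.+1 then bitrev m (k %/ 2)%Z + (k %% 2)%Z * 2 ^+ m else 0.

Lemma bitrev_bound n k : 0 <= bitrev n k < 2 ^+ n.
Proof.
elim: n k => [//|n IH] k /=; have /andP[h1 h2] := IH (k %/ 2)%Z.
rewrite exprS; set p := 2 ^+ n in h1 h2 *.
have : (k %% 2)%Z = 0 \/ (k %% 2)%Z = 1 by lia.
by case=> ->; lia.
Qed.

Lemma bitrev_compat n k : (bitrev n.+1 k %% 2 ^+ n)%Z = bitrev n (k %/ 2)%Z.
Proof. by rewrite /= addrC modzMDl modz_small// bitrev_bound. Qed.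

Lemma bitrev_surj n (a : int) : 0 <= a < 2 ^+ n ->
  exists2 k : int, 0 <= k < 2 ^+ n &
    forall l : int, 0 <= l < 2 ^+ n -> bitrev n l = a <-> l = k.
Proof.
elim: n a => [a a0|n IH a a2].
  by exists 0 => // l; rewrite expr0 in a0 * => l0 /=; lia.
have p0 : (0 : int) < 2 ^+ n by rewrite exprn_gt0.
have [|k kn kP] := IH (a %% 2 ^+ n)%Z.
  by rewrite modz_ge0 ?ltz_pmod// expf_neq0.
have aE := divz_eq a (2 ^+ n).
set q := (a %/ 2 ^+ n)%Z in aE.
have q01 : q = 0 \/ q = 1.
  have : 0 <= q < 2 by rewrite /q divz_ge0// ltz_divLR// -exprS (andP a2).2 (andP a2).1.
  by clearbody q; lia.
exists (2 * k + q); rewrite exprS; set p := 2 ^+ n in kn p0 aE kP *.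
  by lia.
move=> l l2 /=; have := kP (l %/ 2)%Z.
have -> : 0 <= (l %/ 2)%Z < p by lia.
move/(_ isT) => lk.
have /andP[a0 ap] : 0 <= (a %% p)%Z < p.
  by rewrite modz_ge0 ?gt_eqF// ltz_pmod.
have /andP[b0 bp] := bitrev_bound n (l %/ 2)%Z; rewrite -/p in bp.
have l01 : (l %% 2)%Z = 0 \/ (l %% 2)%Z = 1 by lia.
rewrite -/p; split=> [la|lE].
  have lq : (l %% 2)%Z = q.
    move: la b0 bp; set b := bitrev _ _; clearbody b => la b0 bp.
    move: aE a0 ap; set c := (a %% p)%Z; clearbody c => aE a0 ap.
    clearbody q p.
    by case: l01 la => -> la; case: q01 aE => -> aE; clear -la aE b0 bp a0 ap; lia.
  have : bitrev n (l %/ 2)%Z = (a %% p)%Z.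
    by move: la; rewrite lq {1}aE addrC => /addrI.
  by move/lk; lia.
have lq : (l %% 2)%Z = q by lia.
have /lk -> : (l %/ 2)%Z = k by lia.
by rewrite lq addrC -aE.
Qed.

Section haar_existence.
Variable R : realType.

Lemma floor_div2 (t : R) n :
  (Num.floor (2 ^+ n.+1 * t) %/ 2)%Z = Num.floor (2 ^+ n * t).
Proof.
set k := Num.floor _; apply/esym/floor_def.
have /andP[] : k%:~R <= 2 * (2 ^+ n * t) < (k + 1)%:~R.
  by rewrite mulrA -exprS floor_itv.
set q := (k %/ 2)%Z; set y := 2 ^+ n * t; rewrite !intrD.
have : 2%:~R * q%:~R <= k%:~R :> R by rewrite -intrM ler_int /q; lia.
have : (k%:~R + 1%:~R : R) <= 2%:~R * (q%:~R + 1%:~R).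
  by rewrite -!intrD -intrM ler_int /q; lia.
by rewrite !mulr1z => *; apply/andP; split; lra.
Qed.

Fact phi_subproof (t : R) n :
  (bitrev n.+1 (Num.floor (2 ^+ n.+1 * t)) %% 2 ^+ n)%Z
  = bitrev n (Num.floor (2 ^+ n * t)).
Proof. by rewrite bitrev_compat floor_div2. Qed.

Definition phi (t : measurableTypeR R) : Z2 := MkZ2 (phi_subproof t).

Lemma floor_preimage n (k : int) :
  [set t : R | Num.floor (2 ^+ n * t) = k] =
  `[k%:~R / 2 ^+ n, (k + 1)%:~R / 2 ^+ n[%classic.
Proof.
have p0 : (0 : R) < 2 ^+ n by rewrite exprn_gt0.
apply/seteqP; split=> t /=; rewrite in_itv /= ler_pdivrMr// ltr_pdivlMr// mulrC.
  by move=> <-; rewrite floor_itv.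
exact: floor_def.
Qed.

Lemma measurable_phi : measurable_fun setT phi.
Proof.
apply: (measurability _ measurable_cylsE) => _ [_ [->|[n [a ->]]] <-].
  by rewrite preimage_set0 setI0.
rewrite setTI.
have -> : phi @^-1` cyl n a = \bigcup_(k in [set k | bitrev n k = a])
    [set t : R | Num.floor (2 ^+ n * t) = k].
  apply/seteqP; split => [t ta|t [k /= ka tk]].
    by exists (Num.floor (2 ^+ n * t)).
  by rewrite /cyl /= tk.
rewrite bigcup_mkcond; apply: countable_bigcupT_measurable => // k.
by case: ifP => // _; rewrite floor_preimage; exact: measurable_itv.
Qed.

Definition unitR : set (measurableTypeR R) := `[0%R, 1%R[%classic.
Lemma measurable_unitR : measurable unitR. Proof. exact: measurable_itv. Qed.

HB.instance Definition _ := isMeasurableFun.Build _ _ _ _ phi measurable_phi.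

Definition lebesgue01 := mrestr (@lebesgue_measure R) measurable_unitR.

HB.instance Definition _ := Measure.on lebesgue01.

Fact lebesgue01_setT : lebesgue01 setT = 1%E.
Proof.
by rewrite /lebesgue01 /mrestr setTI lebesgue_measure_itv /= lte_fin ltr01 oppr0 adde0.
Qed.

HB.instance Definition _ :=
  Measure_isProbability.Build _ _ _ lebesgue01 lebesgue01_setT.

Definition haar_prob : probability Z2 R := distribution lebesgue01 phi.

Lemma cyl_range n a : cyl n a !=set0 -> 0 <= a < 2 ^+ n.
Proof.
by case=> x <-; rewrite -res_mod modz_ge0 ?expf_neq0//= ltz_pmod ?exprn_gt0.
Qed.

Lemma haar_prob_cyl n a : 0 <= a < 2 ^+ n ->
  haar_prob (cyl n a) = (2 ^- n)%:E.
Proof.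
move=> an; have [k kn kP] := bitrev_surj an.
have p0 : (0 : R) < 2 ^+ n by rewrite exprn_gt0.
rewrite -[LHS]/(lebesgue_measure ((phi @^-1` cyl n a) `&` unitR)).
have -> : (phi @^-1` cyl n a) `&` unitR =
    `[k%:~R / 2 ^+ n, (k + 1)%:~R / 2 ^+ n[%classic.
  rewrite -floor_preimage; apply/seteqP; split=> t /=.
    rewrite /unitR /= in_itv /= => -[ta /andP[t0 t1]]; apply/kP => //.
    rewrite floor_ge0 mulr_ge0 ?(ltW p0)//= floor_lt_int rmorphXn /=.
    by rewrite gtr_pMr.
  move=> tk; split; first by rewrite /cyl /=; apply/kP => //; rewrite tk.
  rewrite /unitR /= in_itv /=; have := floor_itv (2 ^+ n * t); rewrite tk.
  move=> /andP[t0 t1]; move/andP: kn => [k0 k1]; apply/andP; split.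
    by rewrite -(pmulr_rge0 _ p0) (le_trans _ t0)// ler0z.
  rewrite -(ltr_pM2l p0) mulr1 (lt_le_trans t1)//.
  have -> : (2 : R) ^+ n = (2 ^+ n : int)%:~R by rewrite rmorphXn.
  by rewrite ler_int lezD1.
rewrite lebesgue_measure_itv /= lte_fin ltr_pM2r ?invr_gt0// ltr_int ltzD1 lexx.
by rewrite -EFinB -mulrBl intrD addrAC subrr add0r mul1r.
Qed.

Definition translate (a x : Z2) : Z2 := x - a.

Lemma translate_cyl a n b : 0 <= b < 2 ^+ n ->
  translate a @^-1` cyl n b = cyl n ((b + res a n) %% 2 ^+ n)%Z.
Proof.
move=> bn; apply/seteqP; split => x; rewrite /cyl /=.
  by move=> <-; rewrite -[RHS]/(res (translate a x + a) n) /translate subrK.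
move=> xE; rewrite -[LHS]/(res (x + - a) n) resD resN modzDmr xE.
by rewrite modzDml addrK modz_small.
Qed.

Lemma cyl0 n a : ~~ (0 <= a < 2 ^+ n) -> cyl n a = set0.
Proof. by move=> an; apply/eqP; apply: contraNT an => /set0P/cyl_range. Qed.

Lemma measurable_translate a : measurable_fun setT (translate a).
Proof.
apply: (measurability _ measurable_cylsE) => _ [_ [->|[n [b ->]]] <-].
  by rewrite preimage_set0 setI0.
rewrite setTI; have [bn|bn] := boolP (0 <= b < 2 ^+ n).
  by rewrite translate_cyl//; exact: measurable_cyl.
by rewrite cyl0// preimage_set0.
Qed.

HB.instance Definition _ a :=
  isMeasurableFun.Build _ _ _ _ (translate a) (measurable_translate a).

Lemma haar_haar_prob : haar haar_prob.
Proof.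
move=> a A mA; transitivity (distribution haar_prob (translate a) A).
  congr (haar_prob _); apply/seteqP; split=> [_ [x Ax <-]|x xA] /=.
    by rewrite /translate addrC addKr.
  by exists (translate a x) => //; rewrite /translate addrC subrK.
apply: Z2_measure_unique mA => [|n b].
  by apply: (@le_lt_trans _ _ 1%E); [exact: probability_le1 | exact: ltry].
have [bn|bn] := boolP (0 <= b < 2 ^+ n); last by rewrite cyl0// !measure0.
rewrite -[LHS]/(haar_prob (translate a @^-1` cyl n b)) translate_cyl//.
rewrite [RHS]haar_prob_cyl// haar_prob_cyl//.
by rewrite modz_ge0 ?expf_neq0//= ltz_pmod ?exprn_gt0.
Qed.

End haar_existence.

Lemma haar_exists (R : realType) : exists mu : probability Z2 R, haar mu.
Proof. by exists (haar_prob R); exact: haar_haar_prob. Qed.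

Lemma measurable_sphere c r : measurable (sphere c (2 ^- r)).
Proof.
have -> : sphere c (2 ^- r) = translate c @^-1` (cyl r 0 `\` cyl r.+1 0).
  apply/seteqP; split=> [x /eqP|x [x0 x1]].
    by rewrite abs2_eq => /andP[/eqP x0 /eqP x1].
  by apply/eqP; rewrite abs2_eq; apply/andP; split; apply/eqP.
rewrite -[X in measurable X]setTI; apply: measurable_translate => //.
by apply: measurableD; exact: measurable_cyl.
Qed.

(* Main.v *)
(* On the ball S = 1 + 2^r + 2^(r+1) Z_2 and for s odd, x^(s-1) = 1 mod 4, so
   f (x + 2^k h) = f x + 2^k (s h + 4 q) for all k > r.

   If s = 1 mod 4, this makes f an isometry of S that is a translation to second
   order, and f x = x + 2^(r+1) (u 1 + 2 q).  When u 1 is odd, squaring doubles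
   the displacement: the 2^k-th iterate of f moves every x by exactly 2^(r+1+k)
   times an odd number.  Hence f permutes transitively the balls of each level in
   S, so it preserves the measure and an invariant set meets all balls of a given
   level in the same measure; it is then independent of every ball, hence of
   itself.  When u 1 is even, each ball of level r + 2 in S is invariant.

   If s = 3 mod 4, f^2 is the identity modulo 2^(r+3), so the union of two of the
   four balls of level r + 3 in S is invariant. *)
Require Import Defs.
From HB Require Import structures.
From mathcomp Require Import all_boot all_order all_algebra.
From mathcomp Require Import all_classical all_reals all_analysis.
From mathcomp Require Import ring lra zify.

Set Implicit Arguments.
Unset Strict Implicit.
Unset Printing Implicit Defensive.

Import Order.TTheory GRing.Theory Num.Theory.
Local Open Scope classical_set_scope.
Local Open Scope ring_scope.

(** * Congruences and powers in the 2-adic integers *)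

Lemma resP n (x y : Z2) :
  res x n = res y n <-> exists z, x = y + 2 ^+ n * z.
Proof.
split=> [xy|[z ->]]; last by rewrite resD res_mul_pow2// addr0 res_mod.
have [|z zE] := @Z2_divides (x - y) n.
  by rewrite resD resN xy modzDmr subrr mod0z.
by exists z; rewrite -zE addrC subrK.
Qed.

Lemma Z2_parity (z : Z2) : (exists w, z = 2 * w) \/ (exists w, z = 1 + 2 * w).
Proof.
have : res z 1 = 0 \/ res z 1 = 1.
  by have := res_mod z 1; rewrite expr1; lia.
by case=> z1; [left; have [//|w ->] := @Z2_divides z 1|
  right; have /resP[w ->] : res z 1 = res 1 1 by rewrite z1]; exists w.
Qed.

Lemma res_pow2_odd n (w : Z2) : res (2 ^+ n * (1 + 2 * w)) n.+1 != 0.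
Proof.
rewrite mulrDr mulr1 mulrA -exprSr resD res_mul_pow2// addr0 res_mod res_pow2.
by rewrite modz_small ?expf_neq0// exprn_ge0//= ltr_eXn2l.
Qed.

(** The nonzero values of [abs2] are powers [2 ^- k], so bounds on distances amount to congruences
    modulo powers of 2. *)
Lemma lipschitz1P (f : Z2 -> Z2) :
  lipschitz1 f <-> forall n x y, res x n = res y n -> res (f x) n = res (f y) n.
Proof.
have resB x y n : (res (x - y) n == 0) = (res x n == res y n).
  apply/eqP/eqP => [/Z2_divides[z]|]; last first.
    by rewrite resD resN => ->; rewrite modzDmr subrr mod0z.
  by move/eqP; rewrite subr_eq addrC => /eqP ->; apply/resP; exists z.
split=> [fl n x y /eqP|fl x y].
  rewrite -resB -abs2_le => xy; apply/eqP.
  by rewrite -resB -abs2_le (le_trans (fl x y)).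
have [x0|/abs2_pow[k xk]] := eqVneq (abs2 (x - y)) 0.
  have /eqP := x0; rewrite abs2_eq0 subr_eq0 => /eqP ->.
  by rewrite !subrr.
by rewrite xk abs2_le resB; apply/eqP/fl/eqP; rewrite -resB -abs2_le xk.
Qed.

Lemma exprDn_mod_sq (R : comNzRingType) (x d : R) n :
  exists q,
    (x + d) ^+ n.+1 = x ^+ n.+1 + n.+1%:R * (x ^+ n * d) + d ^+ 2 * q.
Proof.
elim: n => [|n [q IH]]; first by exists 0; rewrite !expr1 expr0; ring.
exists (n.+1%:R * x ^+ n + x * q + d * q).
by rewrite [LHS]exprS IH -(natr1 n.+1) !exprS; ring.
Qed.

Lemma odd_sq (x : Z2) w : x = 1 + 2 * w -> exists q, x ^+ 2 = 1 + 4 * q.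
Proof. by move=> ->; exists (w ^+ 2 + w); ring. Qed.

Lemma expr1D_mod (R : comNzRingType) (a q : R) n :
  exists q', (1 + a * q) ^+ n = 1 + a * q'.
Proof.
elim: n => [|n [p IH]]; first by exists 0; rewrite expr0; ring.
by exists (p + q + a * q * p); rewrite exprS IH; ring.
Qed.

(** As [s - 1] is even, [x ^+ (s - 1)] is a power of an odd square, hence 1 mod 4; the terms of
    second order in [d] are absorbed because 4 divides [d]. *)
Lemma expr_odd_diff (x d : Z2) w e s : x = 1 + 2 * w -> d = 4 * e -> odd s ->
  exists q, (x + d) ^+ s = x ^+ s + s%:R * d + 4 * d * q.
Proof.
move=> xE dE so; have sE : s = (s./2 * 2).+1.
  by rewrite -[LHS]odd_double_half so muln2.
have [q] := exprDn_mod_sq x d (s./2 * 2); rewrite -sE => ->.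
have [p pE] := odd_sq xE; have [p' p'E] := expr1D_mod 4 p s./2.
exists (s%:R * p' + e * q).
by rewrite mulnC exprM pE p'E expr2 {2}dE; ring.
Qed.

(** * Odd shifts: iterates and transitivity on residues *)

(** Abstracts from the monomial what survives squaring: [m] grows under iteration while [n] stays
    fixed. With only [2 * q] in the second clause, the doubled displacement could lose its odd
    factor. *)
Definition odd_shift_on (S : set Z2) (n m : nat) (f : Z2 -> Z2) :=
  (forall x, S x -> exists w, f x = x + 2 ^+ m * (1 + 2 * w)) /\
  (forall k x h, (n <= k)%N -> S x ->
    exists q, f (x + 2 ^+ k * h) = f x + 2 ^+ k * (h + 4 * q)).

Lemma cylD n c k x h : (n <= k)%N -> cyl n c x -> cyl n c (x + 2 ^+ k * h).
Proof.
move=> nk xc; rewrite /cyl /mkset resD res_mul_pow2// addr0 xc.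
by rewrite -xc res_mod.
Qed.

Lemma odd_shift_stable n m c f x : (n <= m)%N ->
  odd_shift_on (cyl n c) n m f -> cyl n c x -> cyl n c (f x).
Proof. by move=> nm [H _] xc; have [w ->] := H x xc; exact: cylD. Qed.

(** The consecutive displacements 2^m h and 2^m (h + 4q), with h odd, add up to 2^(m+1) (h + 2q). *)
Lemma odd_shift_iter2 n m c f : (n <= m)%N -> odd_shift_on (cyl n c) n m f ->
  odd_shift_on (cyl n c) n m.+1 (fun x => f (f x)).
Proof.
move=> nm fc; have stab x := @odd_shift_stable _ _ _ _ x nm fc.
case: fc => H1 H2; split=> [x xc|k x h nk xc].
  have [w wE] := H1 x xc; have [q qE] := H2 m x (1 + 2 * w) nm xc.
  by exists (w + q); rewrite {1}wE qE wE exprS; ring.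
have [q ->] := H2 k x h nk xc.
have [q' ->] := H2 k (f x) (h + 4 * q) nk (stab _ xc).
by exists (q + q'); ring.
Qed.

Lemma odd_shift_iter n c f k : odd_shift_on (cyl n c) n n f ->
  odd_shift_on (cyl n c) n (n + k) (iter (2 ^ k) f).
Proof.
move=> fc; elim: k => [|k IH]; first by rewrite addn0.
have := odd_shift_iter2 (leq_addr _ _) IH; rewrite addnS expnS mul2n -addnn.
by congr odd_shift_on; apply/funext => x; rewrite iterD.
Qed.

Lemma cyl_iter n c f i x : odd_shift_on (cyl n c) n n f ->
  cyl n c x -> cyl n c (iter i f x).
Proof.
by move=> fc xc; elim: i => //= i; exact: odd_shift_stable fc.
Qed.

(** The binary digits of [y] are matched one at a time, from level [n] upwards, where all points of
    the ball still agree. *)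
Lemma odd_shift_transitive n c f : odd_shift_on (cyl n c) n n f ->
  forall N x y, cyl n c x -> cyl n c y ->
  exists i, res (iter i f x) N = res y N.
Proof.
move=> fc N x y xc yc.
suff [i iE] : exists i, res (iter i f x) (n + N) = res y (n + N).
  by exists i; rewrite -(res_mod_le _ (leq_addl n N)) iE res_mod_le// leq_addl.
elim: N => [|N [i]].
  by exists 0%N; rewrite addn0 /=; move: xc yc; rewrite /cyl /= => -> ->.
move/esym/resP => [z]; have [[w ->]|[w ->] yE] := Z2_parity z.
  by exists i; rewrite addnS; apply/esym/resP; exists w; rewrite exprSr -mulrA.
(* Digit [n + N] is wrong: [2 ^ N] more steps add an odd multiple of 2^(n+N), which flips it and
   keeps the lower digits. *)
exists (2 ^ N + i)%N; rewrite iterD.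
have [] := odd_shift_iter N fc => H _.
have [v ->] := H _ (cyl_iter i fc xc).
by rewrite addnS; apply/resP; exists (v - w); rewrite yE exprS; ring.
Qed.

Lemma iter_lipschitz1 f i : lipschitz1 f -> lipschitz1 (iter i f).
Proof.
move=> /lipschitz1P fl; apply/lipschitz1P => N x y xy.
by elim: i => //= i IH; exact: fl.
Qed.

(* Modulo [2 ^ N], [f] is inverted by one of its own iterates. *)
Lemma odd_shift_isometry n c f : lipschitz1 f -> odd_shift_on (cyl n c) n n f ->
  forall N x y, cyl n c x -> cyl n c y ->
  res (f x) N = res (f y) N -> res x N = res y N.
Proof.
move=> fl fc N x y xc yc fxy.
have iterK z : cyl n c z -> res (iter (2 ^ N).-1 f (f z)) N = res z N.
  move=> zc; rewrite -iterSr prednK ?expn_gt0//.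
  have [H _] := odd_shift_iter N fc; have [w ->] := H z zc.
  by apply/resP; exists (2 ^+ n * (1 + 2 * w)); rewrite addnC exprD mulrA.
rewrite -(iterK x xc) -(iterK y yc).
by have /lipschitz1P := iter_lipschitz1 (2 ^ N).-1 fl; apply.
Qed.

(** * Measurability, and the Haar measure of balls *)

Lemma lipschitz1_measurable f : lipschitz1 f -> measurable_fun setT f.
Proof.
move=> /lipschitz1P fl.
apply: (measurability _ measurable_cylsE) => _ [_ [->|[n [b ->]]] <-].
  by rewrite preimage_set0 setI0.
rewrite setTI.
(* The preimage is a union of balls of the same level, indexed by the countable type [int]. *)
have -> : f @^-1` cyl n b =
    \bigcup_(a in [set a | exists2 x, res x n = a & res (f x) n = b]) cyl n a.
  apply/seteqP; split=> [x xb|x [_ [y <- yb]] /fl xy].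
    by exists (res x n) => //; exists x.
  by rewrite /cyl /= xy.
rewrite bigcup_mkcond; apply: countable_bigcupT_measurable => // a.
by case: ifP => // _; exact: measurable_cyl.
Qed.

Lemma cyl_splitU n x : cyl n (res x n) =
  cyl n.+1 (res x n.+1) `|` cyl n.+1 (res (x + 2 ^+ n) n.+1).
Proof.
apply/seteqP; split=> [y /resP[z ->]|y []].
- have [[w ->]|[w ->]] := Z2_parity z; [left|right]; apply/resP; exists w;
    by rewrite exprS; ring.
- by move=> /resP[z ->]; apply/resP; exists (2 * z); rewrite exprS; ring.
- by move=> /resP[z ->]; apply/resP; exists (1 + 2 * z); rewrite exprS; ring.
Qed.

Lemma cyl_splitI n x :
  cyl n.+1 (res x n.+1) `&` cyl n.+1 (res (x + 2 ^+ n) n.+1) = set0.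
Proof.
apply/seteqP; split=> // y [yx yx']; have /resP[z] := etrans (esym yx) yx'.
move=> xE; have /eqP := res0 n.+1.
have -> : 0 = 2 ^+ n * (1 + 2 * z).
  by apply: (addrI x); rewrite addr0 {1}xE exprS; ring.
by rewrite (negbTE (res_pow2_odd n z)).
Qed.

Lemma measure_cyl_split (R : realType) (mu : probability Z2 R) E n x :
  measurable E -> mu (E `&` cyl n (res x n)) =
  (mu (E `&` cyl n.+1 (res x n.+1)) +
   mu (E `&` cyl n.+1 (res (x + 2 ^+ n)%R n.+1)))%E.
Proof.
move=> mE; rewrite -measureU; first by rewrite -setIUr -cyl_splitU.
- exact: measurableI mE (measurable_cyl _ _).
- exact: measurableI mE (measurable_cyl _ _).
- by rewrite setIACA cyl_splitI setI0.
Qed.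

Section haar_cyl.
Context (R : realType) (mu : probability Z2 R) (hmu : haar mu).

Lemma haar_cyl_eq n x y : mu (cyl n (res x n)) = mu (cyl n (res y n)).
Proof.
rewrite -(hmu (y - x) (measurable_cyl n (res x n))); congr (mu _).
apply/seteqP; split=> [_ [z /resP[w ->] <-]|z /resP[w ->]].
  by apply/resP; exists w; ring.
by exists (x + 2 ^+ n * w); [apply/resP; exists w|ring].
Qed.

(** The two halves of a ball are translates of each other, so each level halves the measure. *)
Lemma haar_cyl n x : mu (cyl n (res x n)) = (2 ^- n)%:E.
Proof.
elim: n => [|n IH].
  rewrite expr0 invr1 -(probability_setT mu); congr (mu _).
  apply/seteqP; split=> // y _; apply/resP; exists (y - x).
  by rewrite expr0; ring.
have := measure_cyl_split mu n x measurableT.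
rewrite !setTI IH -(haar_cyl_eq n.+1 x (x + 2 ^+ n)).
have := fin_num_measure mu _ (measurable_cyl n.+1 (res x n.+1)).
case: (mu _) => // p _ [pE]; congr EFin.
by rewrite exprS invfM pE; field.
Qed.

End haar_cyl.

Lemma normalized_restr_EFin (R : realType) (mu : {measure set Z2 -> \bar R})
    (S E : set Z2) (p e : R) : mu S = p%:E -> 0 < p -> E `<=` S -> mu E = e%:E ->
  normalized_restr mu S E = (e / p)%:E.
Proof.
move=> Sp p0 ES Ee; rewrite /normalized_restr (setIidl ES) Sp Ee inver.
by rewrite gt_eqF.
Qed.

(** * Measure preservation and ergodicity of odd shifts *)

Section odd_shift_dynamics.
Context (R : realType) (mu : probability Z2 R) (hmu : haar mu).
Context (n : nat) (c : int) (f : Z2 -> Z2).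
Hypotheses (fl : lipschitz1 f) (fc : odd_shift_on (cyl n c) n n f).

Let mS : measurable (cyl n c) := measurable_cyl n c.
Let mf := lipschitz1_measurable fl.
Let stab x : cyl n c x -> cyl n c (f x).
Proof. exact: odd_shift_stable fc. Qed.

Let preimage_cyl N x : cyl n c x ->
  cyl n c `&` f @^-1` cyl N (res (f x) N) = cyl n c `&` cyl N (res x N).
Proof.
move=> xc; apply/seteqP; split=> y [yc yx]; split => //.
  exact: odd_shift_isometry fc _ _ _ yc xc yx.
by have /lipschitz1P := fl; apply.
Qed.

Let res_sub N x : (n <= N)%N -> cyl n c x -> cyl N (res x N) `<=` cyl n c.
Proof. by move=> nN <- t tx; rewrite /cyl /mkset -!(res_mod_le _ nN) tx. Qed.

Lemma odd_shift_preserves_cyl N b :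
  mu (cyl n c `&` f @^-1` cyl N b) = mu (cyl n c `&` cyl N b).
Proof.
have [[y [yc yb]]|/set0P/negP/negPn/eqP S0] := pselect (cyl n c `&` cyl N b !=set0);
    last first.
  rewrite S0; congr (mu _); apply/seteqP; split=> // x [xc xb].
  have : (cyl n c `&` cyl N b) (f x) by split=> //; exact: stab.
  by rewrite S0.
(* Going from [f y] back to [y] along the orbit produces an [x] with [f x] congruent to [y], so the
   preimage is the ball of [x]. *)
have [i] := odd_shift_transitive fc N (stab yc) yc.
rewrite -iterSr /= => iy; have xc := cyl_iter i fc yc.
set x := iter i f y in iy xc.
rewrite -yb -iy preimage_cyl// iy.
case/orP: (leq_total N n) => Nn.
  by congr (mu (_ `&` cyl N _)); rewrite -!(res_mod_le _ Nn) xc yc.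
have sub z : cyl n c z -> cyl N (res z N) `<=` cyl n c.
  by move=> <- t tz; rewrite /cyl /= -!(res_mod_le _ Nn) tz.
by rewrite !setIidr ?(haar_cyl_eq hmu N x y)//; exact: res_sub.
Qed.

Lemma odd_shift_preserves E : measurable E ->
  mu (cyl n c `&` f @^-1` E) = mu (cyl n c `&` E).
Proof.
(* Both sides are finite measures in [E], so comparing them on balls suffices. *)
pose nu : {measure set Z2 -> \bar R} := mrestr mu mS.
pose m1 : {measure set Z2 -> \bar R} := pushforward nu f.
move=> mE; rewrite setIC [in RHS]setIC.
suff: m1 mf E = nu E by [].
apply: Z2_measure_unique mE => [|N b].
  by rewrite (@le_lt_trans _ _ 1%E) ?ltry// -[leLHS]/(mu _) probability_le1// setTI.
suff : mu (f @^-1` cyl N b `&` cyl n c) = mu (cyl N b `&` cyl n c) by [].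
by rewrite setIC odd_shift_preserves_cyl setIC.
Qed.

(** Pulling back by [f] carries the part of [E] near [f z] to the part near [z] and preserves
    measure; transitivity then links any two balls. *)
Lemma invariant_cyl_eq E N x y : measurable E -> E `<=` cyl n c ->
  cyl n c `&` f @^-1` E = E -> cyl n c x -> cyl n c y ->
  mu (E `&` cyl N (res x N)) = mu (E `&` cyl N (res y N)).
Proof.
move=> mE ES fE xc yc; have [i <-] := odd_shift_transitive fc N xc yc.
elim: i => //= i ->; have := cyl_iter i fc xc; set z := iter i f x => zc.
have -> : E `&` cyl N (res z N) = cyl n c `&` f @^-1` (E `&` cyl N (res (f z) N)).
  by rewrite preimage_setI setIIr fE preimage_cyl// setIA (setIidl ES).
rewrite odd_shift_preserves; first by rewrite setIA (setIidr ES).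
exact: measurableI mE (measurable_cyl _ _).
Qed.

Lemma invariant_cyl E (e : R) k x : measurable E -> E `<=` cyl n c ->
  cyl n c `&` f @^-1` E = E -> mu E = e%:E -> cyl n c x ->
  mu (E `&` cyl (n + k) (res x (n + k)%N)) = (e / 2 ^+ k)%:E.
Proof.
move=> mE ES fE Ee xc; elim: k => [|k IH].
  by rewrite addn0 expr0 divr1 -Ee (_ : res x n = c)// (setIidl ES).
have x'c : cyl n c (x + 2 ^+ (n + k)).
  by rewrite -[2 ^+ _]mulr1; apply: cylD xc; exact: leq_addr.
have := measure_cyl_split mu (n + k) x mE.
rewrite IH -(invariant_cyl_eq _ mE ES fE xc x'c) -addnS.
have := fin_num_measure mu _
  (measurableI _ _ mE (measurable_cyl (n + k.+1) (res x (n + k.+1)%N))).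
case: (mu _) => // q _ [qE]; congr EFin.
by rewrite exprS invfM mulrCA qE; field.
Qed.

(* Both [mu S * mu (A & E)] and [mu E * mu (A & S)] are measures in [A], and they
   agree on balls; take [A = E]. *)
Lemma odd_shift_invariant E : measurable E -> E `<=` cyl n c ->
  cyl n c `&` f @^-1` E = E -> mu E = 0%E \/ mu E = (2 ^- n)%:E.
Proof.
move=> mE ES fE; have [e Ee] : exists e, mu E = e%:E.
  by exists (fine (mu E)); rewrite fineK// fin_num_measure.
have e0 : 0 <= e by rewrite -lee_fin -Ee.
have p0 : 0 <= (2 : R) ^- n by rewrite invr_ge0 exprn_ge0.
pose m1 : {measure set Z2 -> \bar R} := mscale (NngNum p0) (mrestr mu mE).
pose m2 : {measure set Z2 -> \bar R} := mscale (NngNum e0) (mrestr mu mS).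
have m1E A : m1 A = ((2 ^- n)%:E * mu (A `&` E))%E by [].
have m2E A : m2 A = (e%:E * mu (A `&` cyl n c))%E by [].
suff: m1 E = m2 E.
  (* With e the measure of [E], the equality reads 2^-n e = e^2. *)
  rewrite m1E m2E setIid (setIidl ES) Ee => -[] /eqP.
  rewrite mulrC -subr_eq0 -mulrBr mulf_eq0 subr_eq0.
  by case/orP => /eqP ->; [left|right].
apply: (@Z2_measure_unique _ m1 m2 _ _ E mE) => [|N b]; first by rewrite m1E setTI Ee ltry.
rewrite m1E m2E setIC [in RHS]setIC.
have [[y [yc yb]]|/set0P/negP/negPn/eqP S0] := pselect (cyl n c `&` cyl N b !=set0);
    last first.
  by rewrite S0 -(setIidl ES) -setIA S0 setI0 measure0 !mule0.
rewrite -{b}yb; case/orP: (leq_total N n) => Nn.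
  have SN : cyl n c `<=` cyl N (res y N).
    by move=> z zc; rewrite /cyl /mkset -!(res_mod_le _ Nn) zc yc.
  rewrite (setIidl SN) (setIidl (subset_trans ES SN)) Ee -yc haar_cyl//.
  by rewrite muleC.
rewrite (setIidr (res_sub Nn yc)) (haar_cyl hmu).
rewrite -(subnKC Nn) (invariant_cyl _ mE ES fE Ee yc) -!EFinM exprD.
by congr EFin; field; rewrite !expf_neq0.
Qed.

Lemma odd_shift_ergodic a : cyl n c a -> ergodic_on mu (cyl n c) f.
Proof.
move=> ac; have Sp : mu (cyl n c) = (2 ^- n)%:E by rewrite -ac haar_cyl.
have p0 : 0 < (2 : R) ^- n by rewrite invr_gt0 exprn_gt0.
split=> [_ [x xc <-]|| E mE ES fE]; first exact: stab.
  split; first exact: measurable_funTS mf.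
  move=> E mE ES; rewrite /normalized_restr.
  rewrite (setIidl (@subIsetl _ _ _)) [E `&` _]setIC.
  congr (_ / _)%E; exact: odd_shift_preserves.
have nE e := @normalized_restr_EFin R mu _ E _ e Sp p0 ES.
case: (odd_shift_invariant mE ES fE) => /nE ->; [left|right].
  by rewrite mul0r.
by rewrite divff// gt_eqF.
Qed.

End odd_shift_dynamics.

(** * The perturbed monomial on the sphere *)

Lemma sphere_cyl r : sphere 1 (2 ^- r) = cyl r.+1 (res (1 + 2 ^+ r) r.+1).
Proof.
rewrite sphereE; apply/seteqP; split=> [_ [z _ <-]|y /resP[z ->]]; last by exists z.
by apply/resP; exists z.
Qed.

Lemma resX_eq n s (x y : Z2) : res x n = res y n -> res (x ^+ s) n = res (y ^+ s) n.
Proof. by move=> xy; elim: s => // s IH; rewrite !exprS !resM xy IH. Qed.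

Lemma nat_mod4 s b : (s = b %[mod 4])%N -> exists m : Z2, s%:R = b%:R + 4 * m.
Proof.
move=> sb; exists ((s %/ 4)%:R - (b %/ 4)%:R).
by rewrite {1}(divn_eq s 4) {1}(divn_eq b 4) sb !natrD !natrM; ring.
Qed.

Section perturbed_monomial.
Context (u : Z2 -> Z2) (hu : lipschitz1 u) (s r : nat) (hr : (1 <= r)%N).

Local Notation f := (fun x : Z2 => x ^+ s + 2 ^+ r.+1 * u x).
Local Notation S := (cyl r.+1 (res (1 + 2 ^+ r) r.+1)).

Lemma perturbed_lipschitz1 : lipschitz1 f.
Proof.
apply/lipschitz1P => n x y xy; have /lipschitz1P/(_ _ _ _ xy) uxy := hu.
by rewrite !resD ![res (_ * _) _]resM uxy (resX_eq s xy).
Qed.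

Let sphere_odd x : S x -> exists w, x = 1 + 2 ^+ r * (1 + 2 * w).
Proof. by move=> /resP[z ->]; exists z; rewrite exprS; ring. Qed.

Let pow2r : 2 ^+ r = 2 * 2 ^+ r.-1 :> Z2.
Proof. by rewrite -exprS prednK. Qed.

Let pow2_4 k : (r < k)%N -> exists e : Z2, 2 ^+ k = 4 * e.
Proof.
move=> rk; exists (2 ^+ (k - 2)); rewrite -[in LHS](subnKC (leq_ltn_trans hr rk)) exprD.
by ring.
Qed.

(** The power is handled by [expr_odd_diff]; the variation of [u] is a multiple of 2^k, and its
    factor 2^(r+1) is divisible by 4. *)
Lemma perturbed_diff k x h : odd s -> (r < k)%N -> S x ->
  exists q, f (x + 2 ^+ k * h) = f x + 2 ^+ k * (s%:R * h + 4 * q).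
Proof.
move=> so rk xS; have [w xE] := sphere_odd xS.
have {}xE : x = 1 + 2 * (2 ^+ r.-1 * (1 + 2 * w)).
  by rewrite {1}xE pow2r; ring.
have [e eE] := pow2_4 rk.
have dE : 2 ^+ k * h = 4 * (e * h) by rewrite eE mulrA.
have [q ->] := expr_odd_diff xE dE so.
have /lipschitz1P/(_ k (x + 2 ^+ k * h) x) := hu.
case/(_ _)/resP => [|p ->]; first by apply/resP; exists h.
have [e' ->] := pow2_4 (ltnSn r).
by exists (h * q + e' * p); ring.
Qed.

(** [x ^+ (s - 1)] is a power of [x ^+ 4], hence 1 modulo 2^(r+2), and [u x] is congruent to [u 1]
    modulo 2^r, in particular modulo 2. *)
Lemma perturbed_shift x : (s = 1 %[mod 4])%N -> S x ->
  exists q, f x = x + 2 ^+ r.+1 * (u 1 + 2 * q).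
Proof.
move=> s1 xS; have [w xE] := sphere_odd xS; set v := 1 + 2 * w in xE.
have sE : s = (4 * (s %/ 4)).+1 by rewrite {1}(divn_eq s 4) s1 mulnC addn1.
have /lipschitz1P/(_ r x 1) := hu.
case/(_ _)/resP => [|p uE]; first by apply/resP; exists v.
have [y x4] : exists y, x ^+ 4 = 1 + 2 ^+ r.+2 * y.
  (* The binomial expansion of (1 + 2^r v)^4, minus 1 and divided by 2^(r+2). *)
  exists (v + 2 ^+ r.-1 * v ^+ 2 * 3 + 4 * (2 ^+ r.-1) ^+ 2 * v ^+ 3
          + 2 * (2 ^+ r.-1) ^+ 3 * v ^+ 4).
  by rewrite xE [2 ^+ r.+2]exprS [2 ^+ r.+1]exprS pow2r; ring.
have [q qE] := expr1D_mod (2 ^+ r.+2) y (s %/ 4).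
exists (x * q + 2 ^+ r.-1 * p).
by rewrite {1}sE exprS exprM x4 qE uE [2 ^+ r.+2]exprS [2 ^+ r.+1]exprS pow2r; ring.
Qed.

Lemma perturbed_odd_shift w : (s = 1 %[mod 4])%N -> u 1 = 1 + 2 * w ->
  odd_shift_on S r.+1 r.+1 f.
Proof.
move=> s1 u1; split=> [x xS|k x h rk xS].
  by have [q ->] := perturbed_shift s1 xS; exists (w + q); rewrite u1; ring.
have so : odd s by rewrite (divn_eq s 4) s1 oddD oddM andbF.
have [q ->] := perturbed_diff h so rk xS; have [m ->] := nat_mod4 s1.
by exists (m * h + q); ring.
Qed.

(** In the coordinate t of x = 1 + 2^r + 2^(r+1) t, [f] acts modulo 4 as the reflection sending t to
    c - t. *)
Lemma perturbed_involutive x : (s = 3 %[mod 4])%N -> S (f (1 + 2 ^+ r)) ->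
  S x -> res (f (f x)) r.+3 = res x r.+3.
Proof.
move=> s3 /resP[c fa] xS.
have so : odd s by rewrite (divn_eq s 4) s3 oddD oddM andbF.
have [m mE] := nat_mod4 s3.
have diff h : exists q,
    f (1 + 2 ^+ r + 2 ^+ r.+1 * h) = f (1 + 2 ^+ r) + 2 ^+ r.+1 * (3 * h + 4 * q).
  have [//|q ->] := @perturbed_diff r.+1 (1 + 2 ^+ r) h so (leqnn _).
  by exists (m * h + q); rewrite mE; ring.
move: xS => /resP[t ->]; have [q ->] := diff t; rewrite fa -addrA -mulrDr.
have [q' ->] := diff (c + (3 * t + 4 * q)); rewrite fa.
apply/resP; exists (c + 2 * t + 3 * q + q').
by rewrite !exprS; ring.
Qed.

(** For even [s], (1 + 2^r)^s is 1 modulo 2^(r+1), so [f] would send the point 1 + 2^r of the sphere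
    off it. *)
Lemma perturbed_stable_odd : S (f (1 + 2 ^+ r)) -> odd s.
Proof.
move=> /resP[z E]; apply: contraT => se.
have sE : s = (2 * s./2)%N by rewrite -[LHS](odd_double_half s) (negbTE se) mul2n.
have [q qE] := expr1D_mod (2 ^+ r.+1 : Z2) (1 + 2 ^+ r.-1) s./2.
have a2 : (1 + 2 ^+ r) ^+ 2 = 1 + 2 ^+ r.+1 * (1 + 2 ^+ r.-1) :> Z2.
  by rewrite [2 ^+ r.+1]exprS pow2r; ring.
have /eqP := res0 r.+1.
have -> : 0 = 2 ^+ r * (1 + 2 * (z - q - u (1 + 2 ^+ r))).
  rewrite {1}sE exprM a2 qE in E.
  apply: (addrI (1 + 2 ^+ r.+1 * q + 2 ^+ r.+1 * u (1 + 2 ^+ r))).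
  by rewrite addr0 {1}E exprS; ring.
by rewrite (negbTE (res_pow2_odd _ _)).
Qed.

End perturbed_monomial.

(** * The ergodicity criterion *)

Lemma ergodic_invariant (R : realType) (mu : probability Z2 R) (S E : set Z2)
    (f : Z2 -> Z2) (p : R) : mu S = p%:E -> 0 < p -> ergodic_on mu S f ->
  measurable E -> E `<=` S -> S `&` f @^-1` E = E ->
  mu E = 0%E \/ mu E = p%:E.
Proof.
move=> Sp p0 [_ _ erg] mE ES fE.
have [e Ee] : exists e, mu E = e%:E.
  by exists (fine (mu E)); rewrite fineK// fin_num_measure.
have := erg E mE ES fE; rewrite (normalized_restr_EFin Sp p0 ES Ee) Ee.
by case=> -[ep]; [left|right]; rewrite -[e](divfK (lt0r_neq0 p0)) ep ?mul0r ?mul1r.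
Qed.

Theorem theorem4p1 (R : realType) (mu : probability Z2 R) (hmu : haar mu)
    (u : Z2 -> Z2) (hu : lipschitz1 u) (s r : nat)
    (hs : (1 <= s)%N) (hr : (1 <= r)%N) :
  ergodic_on mu (sphere 1 (2 ^- r)) (fun x => x ^+ s + 2 ^+ r.+1 * u x) <->
  (s = 1 %[mod 4])%N /\ (exists w : Z2, u 1 = 1 + 2 * w).
Proof.
rewrite sphere_cyl; set f := fun x => _; set a := 1 + 2 ^+ r.
set S := cyl _ _; have aS : S a by [].
have fl : lipschitz1 f := perturbed_lipschitz1 hu s r.
split=> [erg|[s1 [w u1]]]; last first.
  exact: (odd_shift_ergodic hmu fl (perturbed_odd_shift hu hr s1 u1) aS).
have stab x : S x -> S (f x) by case: erg => fS _ _ xS; apply: fS; exists x.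
have p0 k : 0 < (2 : R) ^- k by rewrite invr_gt0 exprn_gt0.
have inv E := @ergodic_invariant _ mu S E f _ (haar_cyl hmu _ a) (p0 _) erg.
have sub k x : S x -> cyl (r.+1 + k) (res x (r.+1 + k)%N) `<=` S.
  move=> xS y /resP[z ->]; rewrite exprD -mulrA; exact: cylD.
have so : odd s := perturbed_stable_odd hr (stab _ aS).
have /orP[/eqP s1|/eqP s3] : (s == 1 %[mod 4])%N || (s == 3 %[mod 4])%N.
- have := ltn_pmod s (isT : (0 < 4)%N); move: so.
  rewrite {1}(divn_eq s 4) oddD oddM andbF.
  by case: (s %% 4)%N => [|[|[|[|]]]].
- split=> //; have [[w u1]|//] := Z2_parity (u 1).
  have fE x : S x -> res (f x) r.+2 = res x r.+2.
    move=> /(perturbed_shift hu hr s1)[q fx].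
    by apply/resP; exists (w + q); rewrite -/f /f fx u1 [2 ^+ r.+2]exprS; ring.
  (* The invariant ball around [a] has half the measure of the sphere. *)
  have E1 := sub 1%N a aS; rewrite addn1 in E1.
  case: (inv _ (measurable_cyl _ _) E1).
  + apply/seteqP; split=> x; first by case=> xS; exact: etrans (esym (fE x xS)).
    by move=> xa; have xS := E1 _ xa; split=> //; exact: etrans (fE x xS) xa.
  + by rewrite haar_cyl// => -[] /eqP; rewrite gt_eqF.
  + rewrite haar_cyl// => -[] /eqP; rewrite lt_eqF//.
    by rewrite ltf_pV2 ?posrE ?exprn_gt0// ltr_eXn2l// ltr1n.
(* [E a] and [E (f a)] are swapped by [f] and may coincide, so their union is only bounded: below by
   one ball, above by two, which is half of the sphere. *)
exfalso; pose E x := cyl r.+3 (res x r.+3).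
have Es x : S x -> E x `<=` S by have := sub 2%N x; rewrite addn2.
have mE x : measurable (E x) by exact: measurable_cyl.
have mu_E x : mu (E x) = (2 ^- r.+3)%:E by exact: haar_cyl.
have ff x : S x -> res (f (f x)) r.+3 = res x r.+3.
  exact: perturbed_involutive (stab _ aS).
have fres x y : res x r.+3 = res y r.+3 -> res (f x) r.+3 = res (f y) r.+3.
  by have /lipschitz1P := fl; apply.
have EU : E a `|` E (f a) `<=` S.
  by rewrite subUset; split; apply: Es => //; exact: stab.
have EE x : (E a `|` E (f a)) x -> (E a `|` E (f a)) (f x).
  by case=> /fres; [right|left]; rewrite /E /cyl /mkset// -(ff a).
case: (inv _ (measurableU _ _ (mE a) (mE (f a))) EU).
- apply/seteqP; split=> x; last by move=> xE; split; [exact: EU|exact: EE].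
  by case=> xS /EE; rewrite /E /cyl /setU /mkset ff.
- move=> E0; have : (mu (E a) <= 0)%E.
    by rewrite -E0 le_measure ?inE//; exact: measurableU.
  by rewrite mu_E lee_fin leNgt p0.
- move=> E1; have : ((2 ^- r.+1)%:E <= (2 ^- r.+3)%:E + (2 ^- r.+3)%:E :> \bar R)%E.
    by rewrite -E1 -{1}(mu_E a) -(mu_E (f a)) measureU2.
  rewrite lee_fin !exprS !invfM; have := p0 r; set q := _ ^- r => q0.
  by lra.
Qed.
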